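(* Let $G$ be a countable group with generators $g_1,g_2,\dots$, let $\omega$ be a free ultrafilter on $\mathbb N$, and let $\Im$ be a family of infinite subsets of $\mathbb N$ such that $F_1\cap F_2$ is finite for all distinct $F_1,F_2\in\Im$. If $G$ is hyperlinear, then the group $G(\omega,\Im)$ is also hyperlinear.
   Context: Definition of $G(\omega,\Im)$: for each $F=\{f_1<f_2<\cdots\}\in\Im$ let $g^F$ be the class modulo $\omega$ of the sequence $(g_n^F)_n$, $g_n^F=g_{f_n}$, i.e. its class in the group $G^{\mathbb N}/\{(h_n)_n:\{n:h_n=e\}\in\omega\}$ (component-wise multiplication). $G(\omega,\Im)$ is the subgroup of this group generated by the elements $g^F$, $F\in\Im$. $R$ is the hyperfinite type $II_1$ factor; for a free ultrafilter $\rho$ on $\mathbb N$, $R^\rho$ is the tracial ultrapower of $R$, $\tau$ its trace, $U(R^\rho)$ its unitary group. A group $H$ (not necessarily countable) is hyperlinear if for some free ultrafilter $\rho$ on $\mathbb N$ there is a homomorphism $\theta:H\to U(R^\rho)$ with $\tau(\theta(h))=0$ for all $h\neq e$. *)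

(* Defs.v *)
From HB Require Import structures.
From mathcomp Require Import all_boot all_order all_algebra.
From mathcomp Require Import generic_quotient sesquilinear complex.
From mathcomp Require Import ring.
From mathcomp Require Import all_classical all_reals all_analysis.

Set Implicit Arguments.
Unset Strict Implicit.
Unset Printing Implicit Defensive.

Import Order.TTheory GRing.Theory Num.Theory.
Import numFieldNormedType.Exports.

Local Open Scope classical_set_scope.
Local Open Scope ring_scope.

Record hilbertSpace (R : realType) := HilbertSpace {
  hilbert_car :> completeNormedModType R[i];
  inner : {dot hilbert_car for Num.conj};
  sqr_norm_inner : forall x : hilbert_car, `|x| ^+ 2 = inner x x
}.

Section Operators.
Context (R : realType) (H : hilbertSpace R).
Implicit Types (S T : H -> H) (A D : set (H -> H)).

Local Notation "'[ x , y ]" := (inner H x y) : ring_scope.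

Definition bounded_op T := linear T /\ continuous T.

Definition adjoint_of S T := forall x y, '[T x, y] = '[x, S y].

(* 0 if there is no adjoint, which never happens for a bounded operator *)
Definition adj T : H -> H := xget 0 [set S | adjoint_of S T].

Definition op_nneg T := forall x, 0 <= '[T x, x].
Definition op_le S T := op_nneg (T - S).

Record star_subalgebra A : Prop := StarSubalgebra {
  subalg_bounded : A `<=` bounded_op;
  subalg1 : A idfun;
  subalg_lin : forall (c : R[i]) S T, A S -> A T -> A (c *: S + T);
  subalg_comp : forall S T, A S -> A T -> A (S \o T);
  subalg_adj : forall T, A T -> exists2 S, A S & adjoint_of S T
}.

(* Closure in B(H) for the weak operator topology *)
Definition weak_closure A : set (H -> H) := [set T | bounded_op T /\
  forall (s : seq (H * H)) (e : R[i]), 0 < e ->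
    exists2 S, A S & forall p, p \in s -> `|'[T p.1, p.2] - '[S p.1, p.2]| < e].

Definition von_neumann_algebra A := star_subalgebra A /\ weak_closure A `<=` A.

Definition finite_dim A := exists s : seq (H -> H), forall T, A T ->
  exists c : nat -> R[i], T = \sum_(i < size s) c i *: s`_i.

Definition op_lub A D T := [/\ A T, (forall S, D S -> op_le S T) &
  forall T', A T' -> (forall S, D S -> op_le S T') -> op_le T T'].

(* Normality is order continuity: tau preserves the suprema of bounded
   increasing nets of positive elements of A (tau S <= tau T for S in the net
   already follows from positivity). The values of tau outside of A are
   irrelevant. *)
Record faithful_normal_trace A (tau : (H -> H) -> R[i]) : Prop :=
  FaithfulNormalTrace {
  trace_lin : forall c S T, A S -> A T -> tau (c *: S + T) = c * tau S + tau T;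
  trace1 : tau idfun = 1;
  traceC : forall S T, A S -> A T -> tau (S \o T) = tau (T \o S);
  trace_ge0 : forall T, A T -> op_nneg T -> 0 <= tau T;
  trace_faithful : forall T, A T -> op_nneg T -> tau T = 0 -> T = 0;
  trace_normal : forall D T,
    D !=set0 ->
    D `<=` [set S | A S /\ op_nneg S] ->
    (forall S1 S2, D S1 -> D S2 ->
       exists S, [/\ D S, op_le S1 S & op_le S2 S]) ->
    op_lub A D T ->
    forall r : R[i], (forall S, D S -> tau S <= r) -> tau T <= r
}.

Definition factor A := forall T, A T -> (forall S, A S -> S \o T = T \o S) ->
  exists c : R[i], T = c *: (idfun : H -> H).

(* An increasing sequence of finite-dimensional unital *-subalgebras with weakly
   dense union *)
Definition hyperfinite A := exists An : nat -> set (H -> H),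
  [/\ forall n, star_subalgebra (An n) /\ finite_dim (An n),
      forall n, An n `<=` An n.+1 &
      weak_closure (\bigcup_n An n) = A].

End Operators.

Record tracialVN (R : realType) := TracialVN {
  vn_space : hilbertSpace R;
  vn_set : set (vn_space -> vn_space);
  vn_trace : (vn_space -> vn_space) -> R[i];
  vn_vonneumann : von_neumann_algebra vn_set;
  vn_traceP : faithful_normal_trace vn_set vn_trace
}.

Arguments vn_set {R} t _.
Arguments vn_trace {R} t _.

(* A II_1 factor is an infinite-dimensional factor with a faithful normal
   tracial state, and a hyperfinite one is unique up to a trace-preserving
   isomorphism (Murray-von Neumann), so "the" factor R is any such N. *)
Definition is_hyperfinite_II1_factor (R : realType) (N : tracialVN R) :=
  [/\ factor (vn_set N), ~ finite_dim (vn_set N) & hyperfinite (vn_set N)].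

Record freeUltrafilter := FreeUltrafilter {
  ultra_set :> set_system nat;
  ultraP : UltraFilter ultra_set;
  ultra_free : forall n, ~ ultra_set [set n]
}.
#[export] Existing Instance ultraP.

Section OperatorFacts.
Context (R : realType) (H : hilbertSpace R).
Implicit Types (S T : H -> H) (c : R[i]).
Local Notation "'[ x , y ]" := (inner H x y) : ring_scope.

Lemma inner_conj (x y : H) : '[x, y] = ('[y, x])^*.
Proof. by rewrite (hermC (inner H)) expr0 mul1r. Qed.

Lemma inner_ge0 (x : H) : 0 <= '[x, x].
Proof. by rewrite -sqr_norm_inner exprn_ge0. Qed.

Lemma innerBl (x y z : H) : '[x - y, z] = '[x, z] - '[y, z].
Proof. exact: linearBl. Qed.

Lemma innerBr (x y z : H) : '[z, x - y] = '[z, x] - '[z, y].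
Proof. exact: linearBr. Qed.

Lemma innerDl (x y z : H) : '[x + y, z] = '[x, z] + '[y, z].
Proof. exact: linearDl. Qed.

Lemma innerDr (x y z : H) : '[z, x + y] = '[z, x] + '[z, y].
Proof. exact: linearDr. Qed.

Lemma inner0l (x : H) : '[0, x] = 0.
Proof. exact: linear0l. Qed.

Lemma inner0r (x : H) : '[x, 0] = 0.
Proof. exact: linear0r. Qed.

Lemma innerZl c (x y : H) : '[c *: x, y] = c * '[x, y].
Proof. exact: linearZl_LR. Qed.

Lemma innerZr c (x y : H) : '[x, c *: y] = c^* * '[x, y].
Proof. by rewrite inner_conj innerZl rmorphM /= -inner_conj. Qed.

Lemma inner_inj (x y : H) : (forall z, '[z, x] = '[z, y]) -> x = y.
Proof.
move=> xy; apply/eqP; rewrite -subr_eq0 -normr_eq0 -sqrf_eq0 sqr_norm_inner.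
by rewrite linearBr /= xy subrr.
Qed.

Lemma adjoint_uniq S S' T : adjoint_of S T -> adjoint_of S' T -> S = S'.
Proof. by move=> h h'; apply/funext => y; apply: inner_inj => x; rewrite -h -h'. Qed.

Lemma adjE S T : adjoint_of S T -> adj T = S.
Proof.
move=> h; apply: adjoint_uniq (h).
by have : [set S | adjoint_of S T] (adj T) by rewrite /adj; case: xgetP => [? -> //|/(_ S)].
Qed.

Lemma adjoint_sym S T : adjoint_of S T -> adjoint_of T S.
Proof. by move=> h x y; rewrite inner_conj -h -inner_conj. Qed.

Lemma adjoint_bound S T c : adjoint_of S T -> 0 < c ->
  (forall x, `|T x| <= c * `|x|) -> forall y, `|S y| <= c * `|y|.
Proof.
move=> ad c0 Tc y; have c_ge0 := ltW c0.
rewrite -ler_sqr ?nnegrE ?mulr_ge0// exprMn.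
have c2 : 0 < c ^+ 2 by rewrite exprn_gt0.
have cc : (c ^+ 2)^* = c ^+ 2 by rewrite conj_Creal// ger0_real// ltW.
have : 0 <= '[T (S y) - c ^+ 2 *: y, T (S y) - c ^+ 2 *: y] by exact: inner_ge0.
have TSy : '[T (S y), y] = `|S y| ^+ 2 by rewrite ad -sqr_norm_inner.
have TSy' : '[y, T (S y)] = `|S y| ^+ 2.
  by rewrite inner_conj TSy conj_Creal// ger0_real// exprn_ge0.
rewrite innerBl !innerBr !innerZl !innerZr cc TSy TSy' -!sqr_norm_inner.
have : `|T (S y)| ^+ 2 <= c ^+ 2 * `|S y| ^+ 2.
  by rewrite -exprMn ler_sqr ?nnegrE ?mulr_ge0.
move=> h1 h2; rewrite -(ler_pM2l c2) -subr_ge0.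
by apply: (le_trans h2); rewrite opprB -[leRHS]add0r lerD2r subr_le0.
Qed.

End OperatorFacts.

Section TracialFacts.
Context (R : realType) (N : tracialVN R).
Local Notation H := (vn_space N).
Local Notation M := (vn_set N).
Local Notation tau := (vn_trace N).
Local Notation "'[ x , y ]" := (inner H x y) : ring_scope.
Implicit Types (S T : H -> H) (c : R[i]).

Let subM : star_subalgebra M := (vn_vonneumann N).1.
Let tauM : faithful_normal_trace M tau := vn_traceP N.

Definition norm2 T : R[i] := sqrtC (tau (adj T \o T)).

Lemma adjP T : M T -> adjoint_of (adj T) T.
Proof. by move=> /(subalg_adj subM)[S MS ad]; rewrite (adjE ad). Qed.

Lemma vn_adj T : M T -> M (adj T).
Proof. by move=> /(subalg_adj subM)[S MS ad]; rewrite (adjE ad). Qed.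

Lemma adjK T : M T -> adj (adj T) = T.
Proof. by move=> MT; apply: adjE; apply: adjoint_sym; apply: adjP. Qed.

Lemma adj_comp S T : M S -> M T -> adj (S \o T) = adj T \o adj S.
Proof. by move=> MS MT; apply: adjE => x y; rewrite /= !adjP. Qed.

Lemma adj_id : adj (idfun : H -> H) = idfun.
Proof. by apply: adjE => x y. Qed.

Lemma adjB S T : M S -> M T -> adj (S - T) = adj S - adj T.
Proof.
move=> MS MT; apply: adjE => x y.
by rewrite !fctE innerBl innerBr !adjP.
Qed.

Lemma vn_comp S T : M S -> M T -> M (S \o T).
Proof. exact: subalg_comp. Qed.

Lemma vnB S T : M S -> M T -> M (S - T).
Proof.
by move=> MS MT; rewrite addrC -scaleN1r; apply: subalg_lin.
Qed.

Lemma vn0 : M 0.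
Proof. by rewrite -(subrr idfun); apply: vnB; apply: subalg1. Qed.

Lemma vnD S T : M S -> M T -> M (S + T).
Proof. by move=> MS MT; rewrite -[S]scale1r; apply: subalg_lin. Qed.

Lemma vnZ c T : M T -> M (c *: T).
Proof. by move=> MT; rewrite -[_ *: _]addr0; apply: subalg_lin => //; apply: vn0. Qed.

Lemma tau0 : tau 0 = 0.
Proof.
have /esym/eqP := trace_lin tauM 1 vn0 vn0.
by rewrite scaler0 addr0 mul1r -{3}[tau 0]addr0 (can_eq (addKr _)) => /eqP.
Qed.

Lemma tauZ c T : M T -> tau (c *: T) = c * tau T.
Proof. by move=> MT; rewrite -[_ *: _]addr0 (trace_lin tauM) ?tau0 ?addr0//; apply: vn0. Qed.

Lemma tauD S T : M S -> M T -> tau (S + T) = tau S + tau T.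
Proof. by move=> MS MT; rewrite -[S in LHS]scale1r (trace_lin tauM) ?mul1r. Qed.

Lemma tau_le S T : M S -> M T -> op_le S T -> tau S <= tau T.
Proof.
move=> MS MT /(trace_ge0 tauM) => /(_ (vnB MT MS)).
rewrite addrC -[- S]scaleN1r (trace_lin tauM)// mulN1r addrC subr_ge0.
exact.
Qed.

Local Notation sq T := (tau (adj T \o T)).

Lemma inner_adj_comp T x : M T -> '[adj T (T x), x] = `|T x| ^+ 2.
Proof. by move=> MT; rewrite sqr_norm_inner (adjoint_sym (adjP MT)). Qed.

Lemma sq_ge0 T : M T -> 0 <= sq T.
Proof.
move=> MT; apply: (trace_ge0 tauM); first by apply: vn_comp => //; apply: vn_adj.
by move=> x; rewrite inner_adj_comp// exprn_ge0.
Qed.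

Lemma sq_adj T : M T -> sq (adj T) = sq T.
Proof. by move=> MT; rewrite adjK// (traceC tauM)//; apply: vn_adj. Qed.

Lemma sq_comp_le S T c : M S -> M T -> 0 <= c ->
  (forall x, `|S x| <= c * `|x|) -> sq (S \o T) <= c ^+ 2 * sq T.
Proof.
move=> MS MT c0 Sc.
have MST := vn_comp MS MT; have MTT := vn_comp (vn_adj MT) MT.
rewrite -tauZ//; apply: tau_le; [exact/vn_comp/MST/vn_adj | exact: vnZ |].
move=> x; rewrite !fctE /= innerBl innerZl (inner_adj_comp x MST).
rewrite inner_adj_comp// subr_ge0 -exprMn ler_pXn2r ?nnegrE ?mulr_ge0//.
exact: Sc.
Qed.

Lemma sq_addB S T : M S -> M T -> sq (S + T) <= 2%:R * (sq S + sq T).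
Proof.
move=> MS MT; have MD := vnD MS MT.
have MSS := vn_comp (vn_adj MS) MS; have MTT := vn_comp (vn_adj MT) MT.
rewrite -tauD// -tauZ; last exact: vnD.
apply: tau_le; [exact/vn_comp/MD/vn_adj | exact/vnZ/vnD |].
move=> x; rewrite !fctE /= innerBl innerZl (inner_adj_comp x MD) !fctE.
rewrite innerDl !inner_adj_comp//.
have := inner_ge0 (S x - T x).
move=> /le_trans; apply.
rewrite !sqr_norm_inner !innerBl !innerBr !innerDl !innerDr.
by rewrite le_eqVlt; apply/orP; left; apply/eqP; ring.
Qed.

(* R[i]^o is R[i] with the topology given by its modulus *)
Definition norm2_null (F : set_system nat) (x : nat -> H -> H) :=
  (norm2 (x n) : R[i]^o) @[n --> F] --> (0 : R[i]^o).

Lemma norm2_nullP (F : set_system nat) {FF : Filter F} (x : nat -> H -> H) :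
  (forall n, M (x n)) ->
  norm2_null F x <-> forall e : R[i], 0 < e -> \forall n \near F, sq (x n) < e.
Proof.
move=> Mx; split=> [/cvgr0Pnorm_lt nx e e0 | nx].
  have : \forall n \near F, `|norm2 (x n)| < sqrtC e.
    by apply: nx; rewrite sqrtC_gt0.
  apply: filterS => n; rewrite /norm2 ger0_norm ?sqrtC_ge0 ?sq_ge0//.
  by rewrite ltr_sqrtC ?nnegrE ?sq_ge0 ?ltW.
apply/cvgr0Pnorm_lt => e e0.
have := nx _ (exprn_gt0 2 e0); apply: filterS => n sn.
rewrite /norm2 ger0_norm ?sqrtC_ge0 ?sq_ge0//.
by rewrite -(sqrCK (ltW e0)) ltr_sqrtC ?nnegrE ?sq_ge0 ?exprn_ge0 ?ltW.
Qed.

Lemma norm2_nullD (F : set_system nat) {FF : Filter F} (x y : nat -> H -> H) :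
  (forall n, M (x n)) -> (forall n, M (y n)) ->
  norm2_null F x -> norm2_null F y -> norm2_null F (fun n => x n + y n).
Proof.
move=> Mx My /norm2_nullP nx /norm2_nullP ny; apply/norm2_nullP.
  by move=> n; apply: vnD.
move=> e e0; have e4 : 0 < e / 4%:R by rewrite divr_gt0.
near=> n; apply: (le_lt_trans (sq_addB (Mx n) (My n))).
have -> : e = 2%:R * (e / 4%:R + e / 4%:R) by field.
rewrite ltr_pM2l// ltrD//.
  by near: n; apply: nx.
by near: n; apply: ny.
Unshelve. all: by end_near. Qed.

Definition bounded_seq (x : nat -> H -> H) := (forall n, M (x n)) /\
  exists c : R[i], forall n v, `|x n v| <= c * `|v|.

Lemma bounded_seq_gt0 x : bounded_seq x ->
  exists2 c : R[i], 0 < c & forall n v, `|x n v| <= c * `|v|.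
Proof.
case=> _ [c xc]; exists (`|c| + 1); first by rewrite ltr_wpDl.
move=> n v; apply: (le_trans (xc n v)).
have [->|v0] := eqVneq v 0; first by rewrite normr0 !mulr0.
rewrite ler_pM2r ?normr_gt0//.
have : 0 <= c * `|v| by apply: le_trans (xc n v).
by rewrite pmulr_lge0 ?normr_gt0// => c0; rewrite ger0_norm// lerDl.
Qed.

Lemma norm2_null_mull (F : set_system nat) {FF : Filter F} (x y : nat -> H -> H) :
  bounded_seq x -> (forall n, M (y n)) ->
  norm2_null F y -> norm2_null F (fun n => x n \o y n).
Proof.
move=> bx My /norm2_nullP ny; have [c c0 xc] := bounded_seq_gt0 bx.
apply/norm2_nullP; first by move=> n; apply: vn_comp => //; apply: bx.1.
move=> e e0; have := ny My (e / c ^+ 2) (divr_gt0 e0 (exprn_gt0 2 c0)).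
apply: filterS => n; rewrite ltr_pdivlMr ?exprn_gt0// mulrC; apply: le_lt_trans.
by apply: sq_comp_le => //; [exact: bx.1 | exact: ltW].
Qed.

Lemma norm2_null_adj (F : set_system nat) (x : nat -> H -> H) :
  (forall n, M (x n)) -> norm2_null F x -> norm2_null F (fun n => adj (x n)).
Proof.
move=> Mx; rewrite /norm2_null.
by under [X in _ -> X @ _ --> _]eq_fun do rewrite /norm2 sq_adj//.
Qed.

Lemma bounded_seq1 : bounded_seq (fun=> idfun).
Proof. by split=> [_|]; [exact: subalg1 | exists 1 => n v; rewrite mul1r]. Qed.

Lemma bounded_seqM x y : bounded_seq x -> bounded_seq y ->
  bounded_seq (fun n => x n \o y n).
Proof.
move=> bx by_; split=> [n|]; first exact: vn_comp (bx.1 n) (by_.1 n).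
have [c c0 xc] := bounded_seq_gt0 bx; have [d d0 yd] := bounded_seq_gt0 by_.
exists (c * d) => n v; apply: (le_trans (xc _ _)).
by rewrite -mulrA ler_pM2l.
Qed.

Lemma bounded_seq_adj x : bounded_seq x -> bounded_seq (fun n => adj (x n)).
Proof.
move=> bx; split=> [n|]; first exact: vn_adj (bx.1 n).
have [c c0 xc] := bounded_seq_gt0 bx; exists c => n.
exact: adjoint_bound (adjP (bx.1 n)) c0 (xc n).
Qed.

Lemma norm2_null_mulr (F : set_system nat) {FF : Filter F} (x y : nat -> H -> H) :
  (forall n, M (x n)) -> bounded_seq y ->
  norm2_null F x -> norm2_null F (fun n => x n \o y n).
Proof.
move=> Mx by_ nx.
have -> : (fun n => x n \o y n) = fun n => adj (adj (y n) \o adj (x n)).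
  apply/funext => n; rewrite -adj_comp ?adjK//; last exact: by_.1.
  by apply: vn_comp => //; apply: by_.1.
apply: norm2_null_adj.
  by move=> n; apply: vn_comp; apply: vn_adj => //; apply: by_.1.
apply: norm2_null_mull; first exact: bounded_seq_adj.
  by move=> n; apply: vn_adj.
exact: norm2_null_adj.
Qed.

End TracialFacts.

Section TracialUltrapower.
Context (R : realType) (N : tracialVN R) (rho : freeUltrafilter).
Local Notation H := (vn_space N).
Local Notation M := (vn_set N).
Local Notation tau := (vn_trace N).
Local Open Scope quotient_scope.

Definition linfty := {x : nat -> H -> H | `[< bounded_seq (N := N) x >]}.
#[export] HB.instance Definition _ := SubChoice.on linfty.
Implicit Types x y : linfty.

Lemma linftyP x : bounded_seq (val x).
Proof. exact/asboolP/(valP x). Qed.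

Lemma linftyM x n : M (val x n).
Proof. exact: (linftyP x).1. Qed.

Definition linfty_of (s : nat -> H -> H) (bs : bounded_seq s) : linfty :=
  exist _ s (asboolT bs).

Definition linfty1 := linfty_of (bounded_seq1 N).
Definition linfty_mul x y := linfty_of (bounded_seqM (linftyP x) (linftyP y)).
Definition linfty_adj x := linfty_of (bounded_seq_adj (linftyP x)).

Definition tequiv x y :=
  `[< norm2_null rho (fun n => val x n - val y n) >].

Lemma tequiv_refl : reflexive tequiv.
Proof.
move=> x; apply/asboolP/norm2_nullP => [n|e e0].
  by apply: vnB; apply: linftyM.
apply: nearW => n; rewrite subrr (_ : _ \o _ = 0) ?tau0//.
apply/funext => v /=; rewrite -[LHS]/(adj 0 0) (adjE (S := 0))//.
by move=> a b; rewrite inner0l inner0r.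
Qed.

Lemma tequiv_sym : symmetric tequiv.
Proof.
suff h x y : tequiv x y -> tequiv y x by move=> x y; apply/idP/idP; apply: h.
have Mx n := linftyM x n; have My n := linftyM y n.
have MB n : M (val y n - val x n) by exact: vnB.
move=> /asboolP h; apply/asboolP.
have -> : (fun n => val y n - val x n) =
   fun n => (- 1 *: idfun) \o (val x n - val y n).
  by apply/funext => n; apply/funext => v; rewrite /= !fctE /= scaleN1r opprB.
apply: norm2_null_mull h => [|n]; last exact: vnB.
split=> [n|]; first by apply: vnZ; apply: subalg1 (vn_vonneumann N).1.
by exists 1 => n v; rewrite !fctE scaleN1r normrN mul1r.
Qed.

Lemma tequiv_trans : transitive tequiv.
Proof.
move=> y x z /asboolP xy /asboolP yz; apply/asboolP.
have -> : (fun n => val x n - val z n) =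
   fun n => (val x n - val y n) + (val y n - val z n).
  by apply/funext => n; rewrite addrA subrK.
by apply: norm2_nullD => // n; apply: vnB; apply: linftyM.
Qed.

Canonical tequiv_equiv := EquivRel tequiv tequiv_refl tequiv_sym tequiv_trans.

Definition tracial_ultrapower := {eq_quot tequiv}.
HB.instance Definition _ := Choice.on tracial_ultrapower.
HB.instance Definition _ := EqQuotient.on tracial_ultrapower.
Implicit Types u v : tracial_ultrapower.

Definition tup1 : tracial_ultrapower := \pi_tracial_ultrapower linfty1.
Definition tup_mul u v : tracial_ultrapower := \pi_tracial_ultrapower (linfty_mul (repr u) (repr v)).
Definition tup_adj u : tracial_ultrapower := \pi_tracial_ultrapower (linfty_adj (repr u)).
(* The limit exists, since (tau (x n)) is bounded, and it does not depend on the
   representative, since `|tau T| <= norm2 T *)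
Definition tup_trace u : R[i] :=
  lim ((tau (val (repr u) n) : R[i]^o) @[n --> ultra_set rho]).

Lemma tup_eqP x y : reflect (norm2_null rho (fun n => val x n - val y n))
  (x == y %[mod tracial_ultrapower]).
Proof. by rewrite eqmodE; apply: asboolP. Qed.

Lemma pi_tup_mul x y : \pi_tracial_ultrapower (linfty_mul x y) =
  tup_mul (\pi_tracial_ultrapower x) (\pi_tracial_ultrapower y).
Proof.
apply/eqP/tup_eqP => /=.
case: piP => x' /eqP/tup_eqP xx; case: piP => y' /eqP/tup_eqP yy.
have -> : (fun n => (val x n \o val y n) - (val x' n \o val y' n)) =
  fun n => ((val x n - val x' n) \o val y n) + (val x' n \o (val y n - val y' n)).
  apply/funext => n; apply/funext => w; rewrite !fctE /=.
  have lx := (subalg_bounded (vn_vonneumann N).1 (linftyM x' n)).1.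
  have lB := zmod_morphism_linear lx.
  by rewrite lB addrA subrK.
have Mx n := linftyM x n; have My n := linftyM y n.
have Mx' n := linftyM x' n; have My' n := linftyM y' n.
apply: norm2_nullD => [n|n||]; try by apply: vn_comp => //; apply: vnB.
- by apply: norm2_null_mulr => // [n|]; [exact: vnB | exact: linftyP].
- by apply: norm2_null_mull => // [|n]; [exact: linftyP | exact: vnB].
Qed.

Lemma pi_tup_adj x : \pi_tracial_ultrapower (linfty_adj x) =
  tup_adj (\pi_tracial_ultrapower x).
Proof.
apply/eqP/tup_eqP => /=; case: piP => x' /eqP/tup_eqP xx.
have -> : (fun n => adj (val x n) - adj (val x' n)) =
  fun n => adj (val x n - val x' n).
  by apply/funext => n; rewrite adjB//; apply: linftyM.
by apply: norm2_null_adj => // n; apply: vnB; apply: linftyM.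
Qed.

Fact tup_mulA : associative tup_mul.
Proof.
move=> u v w; rewrite -[u]reprK -[v]reprK -[w]reprK.
rewrite -(pi_tup_mul (repr v) (repr w)) -(pi_tup_mul (repr u) (repr v)) -!pi_tup_mul.
by congr (\pi_tracial_ultrapower _); apply: val_inj.
Qed.

Fact tup_mul1 : right_id tup1 tup_mul.
Proof.
move=> u; rewrite -[u]reprK; rewrite -pi_tup_mul; congr (\pi_tracial_ultrapower _).
exact: val_inj.
Qed.

Fact tup_1mul : left_id tup1 tup_mul.
Proof.
move=> u; rewrite -[u]reprK; rewrite -pi_tup_mul; congr (\pi_tracial_ultrapower _).
exact: val_inj.
Qed.

HB.instance Definition _ :=
  isMonoid.Build tracial_ultrapower tup_mulA tup_1mul tup_mul1.

Local Open Scope group_scope.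

Lemma tup_adj1 : tup_adj 1 = 1.
Proof.
rewrite -pi_tup_adj; congr (\pi_tracial_ultrapower _); apply: val_inj.
by apply/funext => n; apply: adj_id.
Qed.

Lemma tup_adjM u v : tup_adj (u * v) = tup_adj v * tup_adj u.
Proof.
rewrite -[LHS]/(tup_adj (tup_mul u v)) -[RHS]/(tup_mul (tup_adj v) (tup_adj u)).
rewrite -[u]reprK -[v]reprK -(pi_tup_mul (repr u)) -!pi_tup_adj.
rewrite -(pi_tup_mul (linfty_adj (repr v))).
congr (\pi_tracial_ultrapower _); apply: val_inj.
by apply/funext => n; apply: adj_comp; apply: linftyM.
Qed.

Lemma tup_adjK : involutive tup_adj.
Proof.
move=> u; rewrite -[u]reprK -(pi_tup_adj (repr u)) -(pi_tup_adj (linfty_adj _)).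
congr (\pi_tracial_ultrapower _).
by apply: val_inj; apply/funext => n; apply: adjK; apply: linftyM.
Qed.

Definition is_unitary u := (tup_adj u * u == 1) && (u * tup_adj u == 1).

Definition unitary_group := {u : tracial_ultrapower | is_unitary u}.
HB.instance Definition _ := SubChoice.on unitary_group.
Implicit Types p q : unitary_group.

Fact unitary1 : is_unitary 1.
Proof. by rewrite /is_unitary tup_adj1 mulg1 eqxx. Qed.

Fact unitaryM p q : is_unitary (val p * val q).
Proof.
have /andP[/eqP p1 /eqP p2] := valP p; have /andP[/eqP q1 /eqP q2] := valP q.
rewrite /is_unitary tup_adjM; apply/andP; split; apply/eqP.
  by rewrite mulgA -(mulgA (tup_adj (val q))) p1 mulg1.
by rewrite mulgA -(mulgA (val p)) q2 mulg1.
Qed.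

Fact unitaryV p : is_unitary (tup_adj (val p)).
Proof. by rewrite /is_unitary tup_adjK andbC; apply: (valP p). Qed.

Definition unitary_one : unitary_group := exist is_unitary _ unitary1.
Definition unitary_mul p q : unitary_group := exist is_unitary _ (unitaryM p q).
Definition unitary_inv p : unitary_group := exist is_unitary _ (unitaryV p).

Fact unitary_mulA : associative unitary_mul.
Proof. by move=> p q r; apply: val_inj; apply: mulgA. Qed.

Fact unitary_1mul : left_id unitary_one unitary_mul.
Proof. by move=> p; apply: val_inj; apply: mul1g. Qed.

Fact unitary_mul1 : right_id unitary_one unitary_mul.
Proof. by move=> p; apply: val_inj; apply: mulg1. Qed.

Fact unitary_mulV : left_inverse unitary_one unitary_inv unitary_mul.
Proof. by move=> p; apply: val_inj; have /andP[/eqP] := valP p. Qed.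

Fact unitary_Vmul : right_inverse unitary_one unitary_inv unitary_mul.
Proof. by move=> p; apply: val_inj; have /andP[_ /eqP] := valP p. Qed.

HB.instance Definition _ := isGroup.Build unitary_group
  unitary_mulA unitary_1mul unitary_mul1 unitary_mulV unitary_Vmul.

End TracialUltrapower.

Definition hyperlinear (R : realType) (N : tracialVN R) (K : groupType) :=
  exists (rho : freeUltrafilter) (theta : {multiplicative K -> unitary_group N rho}),
    forall h : K, h <> 1%g -> tup_trace (val (theta h)) = 0.

Section GroupUltrapower.
Context (G : groupType) (omega : freeUltrafilter).
Local Open Scope quotient_scope.
Local Open Scope group_scope.
Implicit Types h k : nat -> G.

Definition uequiv h k := `[< \forall n \near ultra_set omega, h n = k n >].

Lemma uequiv_refl : reflexive uequiv.
Proof. by move=> h; apply/asboolP; apply: nearW. Qed.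

Lemma uequiv_sym : symmetric uequiv.
Proof.
by move=> h k; apply/asboolP/asboolP; apply: filterS => n ->.
Qed.

Lemma uequiv_trans : transitive uequiv.
Proof.
move=> k h l /asboolP hk /asboolP kl; apply/asboolP.
by apply: filterS2 hk kl => n -> ->.
Qed.

Canonical uequiv_equiv := EquivRel uequiv uequiv_refl uequiv_sym uequiv_trans.

Definition group_ultrapower := {eq_quot uequiv}.
HB.instance Definition _ := Choice.on group_ultrapower.
HB.instance Definition _ := EqQuotient.on group_ultrapower.
Implicit Types a b : group_ultrapower.

Definition class_mod h : group_ultrapower := \pi_group_ultrapower h.

Lemma class_modP h k :
  class_mod h = class_mod k <-> \forall n \near ultra_set omega, h n = k n.
Proof.
split=> [/eqP|hk]; first by rewrite eqmodE => /asboolP.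
by apply/eqP; rewrite eqmodE; apply/asboolP.
Qed.

Lemma class_modK a : class_mod (repr a) = a.
Proof. exact: reprK. Qed.

Definition gup_one := class_mod (fun=> 1).
Definition gup_mul a b := class_mod (fun n => repr a n * repr b n).
Definition gup_inv a := class_mod (fun n => (repr a n)^-1).

Lemma near_repr h : \forall n \near ultra_set omega, repr (class_mod h) n = h n.
Proof. by apply/class_modP; rewrite class_modK. Qed.

Lemma class_modM h k :
  class_mod (fun n => h n * k n) = gup_mul (class_mod h) (class_mod k).
Proof.
apply/class_modP; near=> n; congr (_ * _); apply/esym; near: n; exact: near_repr.
Unshelve. all: by end_near. Qed.

Lemma class_modV h : class_mod (fun n => (h n)^-1) = gup_inv (class_mod h).
Proof.
apply/class_modP; near=> n; congr (_^-1); apply/esym; near: n; exact: near_repr.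
Unshelve. all: by end_near. Qed.

Fact gup_mulA : associative gup_mul.
Proof.
move=> a b c; rewrite -(class_modK a) -(class_modK b) -(class_modK c) -(class_modM (repr b)) -(class_modM (repr a) (repr b)) -!class_modM.
by congr class_mod; apply/funext => n; apply: mulgA.
Qed.

Fact gup_1mul : left_id gup_one gup_mul.
Proof.
move=> a; rewrite -(class_modK a) -class_modM.
by congr class_mod; apply/funext => n; apply: mul1g.
Qed.

Fact gup_mul1 : right_id gup_one gup_mul.
Proof.
move=> a; rewrite -(class_modK a) -class_modM.
by congr class_mod; apply/funext => n; apply: mulg1.
Qed.

Fact gup_mulV : left_inverse gup_one gup_inv gup_mul.
Proof.
move=> a; rewrite -(class_modK a) -class_modV -class_modM.
by congr class_mod; apply/funext => n; apply: mulVg.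
Qed.

Fact gup_Vmul : right_inverse gup_one gup_inv gup_mul.
Proof.
move=> a; rewrite -(class_modK a) -class_modV -class_modM.
by congr class_mod; apply/funext => n; apply: mulgV.
Qed.

HB.instance Definition _ := isGroup.Build group_ultrapower
  gup_mulA gup_1mul gup_mul1 gup_mulV gup_Vmul.

End GroupUltrapower.

Section GeneratedSubgroup.
Context (K : groupType).
Local Open Scope group_scope.

Definition subgroup (S : set K) :=
  [/\ S 1, forall x y, S x -> S y -> S (x * y) & forall x, S x -> S x^-1].

Definition generated (A : set K) : set K :=
  [set x | forall S, subgroup S -> A `<=` S -> S x].

Definition generated_group (A : set K) := {x : K | x \in generated A}.
HB.instance Definition _ A := SubChoice.on (generated_group A).

Fact generated_closed A : group_closed (mem (generated A)).
Proof.
split=> [|x y]; first by apply/mem_set => S [].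
rewrite !inE => gx gy S sS AS; case: (sS) => _ SM SV.
by apply: SM; [apply: gx | apply: SV; apply: gy].
Qed.

HB.instance Definition _ A := SubChoice_isSubGroup.Build K
  (mem (generated A)) (generated_group A) (generated_closed A).

End GeneratedSubgroup.

Definition is_enumeration (F : set nat) (f : nat -> nat) :=
  {homo f : m n / (m < n)%N} /\ range f = F.

(* The classes g^F of the sequences n |-> g_(f_n), for F = {f_0 < f_1 < ...} in I *)
Definition gF_set (G : groupType) (g : nat -> G) (omega : freeUltrafilter)
    (I : set (set nat)) : set (group_ultrapower G omega) :=
  [set x | exists F f, [/\ I F, is_enumeration F f &
     x = class_mod omega (fun n => g (f n))]].
Arguments gF_set {G} g omega I _.

Definition G_omega_I (G : groupType) (g : nat -> G) (omega : freeUltrafilter)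
  (I : set (set nat)) : groupType := generated_group (gF_set g omega I).

Definition generates (G : groupType) (g : nat -> G) :=
  generated (range g) = setT.

(* Main.v *)
Require Import Defs.
From HB Require Import structures.
From mathcomp Require Import all_boot all_order all_algebra.
From mathcomp Require Import generic_quotient complex ring.
From mathcomp Require Import all_classical all_reals all_analysis.
Set Implicit Arguments.
Unset Strict Implicit.
Unset Printing Implicit Defensive.
Import Order.TTheory GRing.Theory Num.Theory.
Import numFieldNormedType.Exports.
Local Open Scope classical_set_scope.

(** The whole ultrapower of G along omega is hyperlinear as soon as G is, and
    G_omega_I is a subgroup of it; restricting a trace-zero homomorphism to a
    subgroup keeps the trace condition.

    Let theta be a homomorphism from G to the unitaries of the ultrapower of N
    along rho, with trace zero away from 1. For each h in G choose a sequence
    (f h m)_m of operators representing theta h. The class of (h_j)_j in the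
    ultrapower of G goes to the class of the double sequence f (h_j) m, taken
    along the product ultrafilter of omega and rho: a set of pairs is large when
    for omega-almost all j it contains (j, m) for rho-almost all m
    ([prod_freeUltrafilter], transported to nat by a coding of pairs).
    Multiplicativity, unitarity and vanishing of the trace are limits along rho
    for each fixed j, hence hold along the product ([cvg_prod_ultra]).

    Two points need work. The double sequence must be bounded in operator norm,
    although a unitary of the ultrapower may be represented by sequences of
    arbitrarily large norm, so f h has to be chosen with a bound independent of
    h. The usual argument is polar decomposition; here a polynomial suffices. If
    T has squared norm at most L >= 2, then T + T (1 - T* T) / L has squared norm
    at most L / 2, and it agrees with T in the ultrapower when T* T does with 1.
    Iterating gives representatives by contractions ([unitary_lift]).
    Second, the trace of the ultrapower is a limit, which is only informative
    once it is known to exist and to be independent of the representative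
    ([tup_trace_cvg]): this follows from compactness of discs and from the
    inequality |tau T|^2 <= tau (T* T) ([tau_sqr_le]). *)

(** * Ultrafilters and limits of bounded sequences *)

Lemma ultra_of_dichotomy (T : Type) (F : set_system T) : ProperFilter F ->
  (forall A, F A \/ F (~` A)) -> UltraFilter F.
Proof.
move=> PF FAC; split=> // G PG FG; apply/seteqP; split=> // A GA.
have [//|/FG GnA] := FAC A.
by case: (filter_not_empty G); rewrite -(setICr A); apply: filterI.
Qed.

Lemma fmap_ultra (T U : Type) (f : T -> U) (F : set_system T) :
  UltraFilter F -> UltraFilter (f @ F).
Proof.
move=> UF; apply: ultra_of_dichotomy => A.
exact: (in_ultra_setVsetC (f @^-1` A) UF).
Qed.

Section BoundedCvg.
Context (R : realType) (F : set_system nat) (UF : UltraFilter F).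
Local Open Scope ring_scope.
Local Open Scope complex_scope.

Lemma ultra_bounded_cvg_real (f : nat -> R) (c : R) :
  (forall n, `|f n| <= c) -> exists l : R, f @ F --> l.
Proof.
move=> fc; have /= := @segment_compact R (- c) c.
rewrite compact_ultra => /(_ (f @ F) (fmap_ultra f UF)).
case=> [|l [_ fl]]; last by exists l.
by apply: nearW => n /=; rewrite in_itv /= -ler_norml.
Qed.

Lemma ultra_bounded_cvg (f : nat -> R[i]) (c : R[i]) :
  (forall n, `|f n| <= c) -> exists l : R[i], (f n : R[i]^o) @[n --> F] --> (l : R[i]^o).
Proof.
move=> fc.
have fc' n : complex.Re `|f n| <= complex.Re c.
  by have := fc n; rewrite lecE; case/andP.
have bRe n : `|complex.Re (f n)| <= complex.Re c.
  apply: le_trans (fc' n); rewrite normc_def /= -sqrtr_sqr.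
  by rewrite ler_sqrt ?lerDl ?sqr_ge0// addr_ge0 ?sqr_ge0.
have bIm n : `|complex.Im (f n)| <= complex.Re c.
  apply: le_trans (fc' n); rewrite normc_def /= -sqrtr_sqr.
  by rewrite ler_sqrt ?lerDr ?sqr_ge0// addr_ge0 ?sqr_ge0.
have [a fa] := ultra_bounded_cvg_real bRe.
have [b fb] := ultra_bounded_cvg_real bIm.
exists (a +i* b); apply/cvgrPdist_lt => e e0.
have er : (complex.Re e)%:C = e by rewrite RRe_real// gtr0_real.
have e2 : 0 < complex.Re e / 2 by rewrite divr_gt0// -ltcR er.
near=> n.
have -> : e = (complex.Re e / 2)%:C + (complex.Re e / 2)%:C by rewrite -rmorphD /= -splitr er.
rewrite [_ - _]complexE; apply: le_lt_trans (ler_normD _ _) _.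
rewrite normrM.
have -> : `|'i : R[i]| = 1 by rewrite normc_def /= expr0n expr1n add0r sqrtr1.
rewrite mul1r !normc_def /= !expr0n /= !addr0 !sqrtr_sqr ltrD// ltcR.
  rewrite (_ : complex.Re _ = a - complex.Re (f n)); last by case: (f n).
  by near: n; apply: (cvgr_dist_lt _ _ fa).
rewrite (_ : complex.Im _ = b - complex.Im (f n)); last by case: (f n).
by near: n; apply: (cvgr_dist_lt _ _ fb).
Unshelve. all: by end_near. Qed.

End BoundedCvg.

(** * The product of two ultrafilters on nat *)

Definition unpair (k : nat) : nat * nat := odflt (0, 0) (unpickle k).

Lemma pairK p : unpair (pickle p) = p.
Proof. by rewrite /unpair pickleK. Qed.

Section ProductUltrafilter.
Context (omega rho : freeUltrafilter).

(** The iterated (Fubini) product of omega and rho; the order of the two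
    quantifiers matters. *)
Definition prod_ultra : set_system nat :=
  [set A | \forall n \near ultra_set omega, \forall m \near ultra_set rho, A (pickle (n, m))].

Lemma prod_ultraP : UltraFilter prod_ultra.
Proof.
apply: ultra_of_dichotomy => [|A].
  split.
    move=> h; have [n h'] := @filter_ex _ omega _ _ h.
    by have [] := @filter_ex _ rho _ _ h'.
  split.
  - by apply: (@nearW _ omega) => n; apply: (@nearW _ rho) => m.
  - by move=> A B; apply: (@filterS2 _ omega) => n; apply: (@filterS2 _ rho).
  - by move=> A B AB; apply: (@filterS _ omega) => n; apply: (@filterS _ rho) => m; apply: AB.
have [oA|oA] := in_ultra_setVsetC
  [set n | \forall m \near ultra_set rho, A (pickle (n, m))] (ultraP omega).
  by left.
right; move: oA; apply: filterS => n.
by have [rA //|rA _] := in_ultra_setVsetC [set m | A (pickle (n, m))] (ultraP rho).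
Qed.

Lemma prod_ultra_free k : ~ prod_ultra [set k].
Proof.
move=> h; have [n rk] := @filter_ex _ omega _ _ h; apply: (@ultra_free rho (unpair k).2).
by move: rk; apply: filterS => m <-; rewrite pairK.
Qed.

Definition prod_freeUltrafilter : freeUltrafilter :=
  @FreeUltrafilter prod_ultra prod_ultraP prod_ultra_free.

Lemma cvg_prod_ultra (T : topologicalType) (s : nat -> nat -> T) (l : T) :
  (\forall n \near ultra_set omega, s n m @[m --> ultra_set rho] --> l) ->
  s (unpair k).1 (unpair k).2 @[k --> ultra_set prod_freeUltrafilter] --> l.
Proof.
move=> sl A Al; move: sl; apply: (@filterS _ omega) => n /(_ A Al).
apply: (@filterS _ rho) => m.
by rewrite /= pairK.
Qed.

End ProductUltrafilter.

(** * The trace of the ultrapower as a limit *)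

Section Trace.
Context (R : realType) (N : tracialVN R).
Local Notation H := (vn_space N).
Local Notation M := (vn_set N).
Local Notation tau := (vn_trace N).
Local Notation "'[ x , y ]" := (inner H x y) : ring_scope.
Local Open Scope ring_scope.
Implicit Types (S T : H -> H) (c : R[i]).

Lemma vn_id : M idfun.
Proof. exact: subalg1 (vn_vonneumann N).1. Qed.

Lemma vn_linear T : M T -> linear T.
Proof. by move=> MT; have [] := subalg_bounded (vn_vonneumann N).1 MT. Qed.

Lemma adjZ c T : M T -> adj (c *: T) = c^* *: adj T.
Proof.
move=> MT; apply: adjE => x y.
by rewrite !fctE innerZl innerZr conjCK adjP.
Qed.

Lemma adjD S T : M S -> M T -> adj (S + T) = adj S + adj T.
Proof.
move=> MS MT; apply: adjE => x y.
by rewrite !fctE innerDl innerDr !adjP.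
Qed.

Lemma sq_add_scalar T c : M T -> tau (adj (T + c *: idfun) \o (T + c *: idfun)) =
  tau (adj T \o T) + c * tau (adj T) + c^* * tau T + c * c^*.
Proof.
move=> MT; have MA := vn_adj MT; have M1 := vn_id.
rewrite adjD ?adjZ ?adj_id//; last exact: vnZ.
have -> : (adj T + c^* *: idfun) \o (T + c *: idfun) =
  (adj T \o T + c *: adj T) + (c^* *: T + (c * c^*) *: idfun).
  apply/funext => v; rewrite !fctE /=; have lA := vn_linear MA.
  rewrite [T v + _]addrC lA scalerDr scalerA [c^* * c]mulrC.
  by rewrite [c *: _ + _]addrC [(_ * _) *: _ + _]addrC.
have MAT := vn_comp MA MT.
rewrite tauD ?tauD ?tauZ//; try by [exact: vnZ | apply: vnD => //; exact: vnZ].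
by rewrite (trace1 (vn_traceP N)) mulr1 addrA.
Qed.

(** Positivity of tau forces it to be hermitian: for c = 1 and c = 'i, the
    nonnegative number tau ((T + c)* (T + c)) differs by a real number from
    c tau(T* ) + c* tau(T), and these two real combinations determine tau(T* ). *)
Lemma tau_adj T : M T -> tau (adj T) = (tau T)^*.
Proof.
move=> MT; set A := tau T; set B := tau (adj T).
have real_part c : (c * B + c^* * A)^* = c * B + c^* * A.
  apply: conj_Creal.
  have := sq_ge0 (vnD MT (vnZ c vn_id)); rewrite sq_add_scalar// -/A -/B.
  have -> : c * B + c^* * A = (tau (adj T \o T) + c * B + c^* * A + c * c^*) -
     (tau (adj T \o T) + c * c^*) by ring.
  by move=> h; apply: rpredB; apply: ger0_real => //; rewrite addr_ge0 ?sq_ge0// mul_conjC_ge0.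
have := real_part 1; have := real_part 'i.
rewrite !rmorphD !rmorphM /= !conjCK conjCi conjC1 !mul1r !mulNr => hi h1.
have {}hi : A^* - B^* = B - A.
  apply: (mulfI (neq0Ci _)); rewrite !mulrBr -hi addrC; ring.
apply: (mulfI (_ : 2%:R != 0 :> R[i])); first by rewrite pnatr_eq0.
transitivity ((B - A) + (B + A)); first by ring.
rewrite -hi -h1; ring.
Qed.

(** Expand 0 <= tau ((T - c)* (T - c)) at the minimizing c = tau T. *)
Lemma tau_sqr_le T : M T -> `|tau T| ^+ 2 <= tau (adj T \o T).
Proof.
move=> MT.
have := sq_ge0 (vnD MT (vnZ (- tau T) vn_id)).
rewrite sq_add_scalar// tau_adj// rmorphN /= !mulNr mulrN opprK normCK.
by rewrite [_^* * _]mulrC subrK subr_ge0.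
Qed.

Context (rho : freeUltrafilter).
Implicit Types x y : linfty N.
Local Notation tpi := (\pi_(tracial_ultrapower N rho)%qT).

Lemma norm2_null_tau (F : set_system nat) {FF : Filter F} (s : nat -> H -> H) :
  (forall n, M (s n)) -> norm2_null F s -> (tau (s n) : R[i]^o) @[n --> F] --> (0 : R[i]^o).
Proof.
move=> Ms /(norm2_nullP Ms) ns; apply/cvgr0Pnorm_lt => e e0.
apply: filterS (ns _ (exprn_gt0 2 e0)) => n sn.
rewrite -(ltr_pXn2r (ltn0Sn 1)) ?nnegrE ?normr_ge0 ?(ltW e0)//.
exact: le_lt_trans (tau_sqr_le (Ms n)) sn.
Qed.

Lemma linfty_tau_bounded x : exists c : R[i], forall n, `|tau (val x n)| <= c.
Proof.
have [c c0 xc] := bounded_seq_gt0 (linftyP x); exists c => n.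
rewrite -(ler_pXn2r (ltn0Sn 1)) ?nnegrE ?normr_ge0 ?(ltW c0)//.
apply: le_trans (tau_sqr_le (linftyM x n)) _.
have := sq_comp_le (linftyM x n) vn_id (ltW c0) (xc n).
by rewrite adj_id (trace1 (vn_traceP N)) mulr1.
Qed.

(** [tup_trace] is a [lim], whose value carries no information unless the
    sequence converges, and it is computed on the chosen representative; both
    gaps are closed here, for an arbitrary representative [x]. *)
Lemma tup_trace_cvg x : (tau (val x n) : R[i]^o) @[n --> ultra_set rho] -->
  (tup_trace (tpi x) : R[i]^o).
Proof.
have [c yc] := linfty_tau_bounded (repr (tpi x)).
have [l yl] := ultra_bounded_cvg (ultraP rho) yc.
have -> : tup_trace (tpi x) = l by apply: cvg_lim yl; exact: norm_hausdorff.
have /eqP/tup_eqP xy : x = repr (tpi x) %[mod tracial_ultrapower N rho]%qT.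
  by rewrite reprK.
have MB n : M (val x n - val (repr (tpi x)) n) by apply: vnB; apply: linftyM.
have -> : (fun n => tau (val x n)) =
    (fun n => tau (val x n - val (repr (tpi x)) n) + tau (val (repr (tpi x)) n)).
  by apply/funext => n; rewrite -tauD ?subrK//; exact: linftyM.
rewrite -[l]add0r; exact: cvgD (norm2_null_tau MB xy) yl.
Qed.

Lemma tup_trace_pi x (l : R[i]) :
  (tau (val x n) : R[i]^o) @[n --> ultra_set rho] --> (l : R[i]^o) -> tup_trace (tpi x) = l.
Proof.
move=> xl; rewrite -[RHS](cvg_lim (@norm_hausdorff _ R[i]^o) xl).
exact/esym/(cvg_lim (@norm_hausdorff _ R[i]^o))/tup_trace_cvg.
Qed.

End Trace.

(** * Uniformly bounded representatives of unitaries *)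

Section Truncation.
Context (R : realType) (N : tracialVN R).
Local Notation H := (vn_space N).
Local Notation M := (vn_set N).
Local Notation "'[ x , y ]" := (inner H x y) : ring_scope.
Local Open Scope ring_scope.
Implicit Types (T : H -> H) (L : R[i]).

(** One step of a Newton-Schulz type iteration towards the unitary part of T: the
    singular value t becomes t (1 + (1 - t^2) / L), which fixes 1 and contracts
    large values. *)
Definition truncate L T : H -> H := T + L^-1 *: (T \o (idfun - (adj T \o T))).

Lemma vn_truncate L T : M T -> M (truncate L T).
Proof.
move=> MT; apply: vnD => //; apply: vnZ; apply: vn_comp => //.
apply: vnB; first exact: vn_id.
by apply: vn_comp => //; apply: vn_adj.
Qed.

(** With a = T* T and b = L + 1, the squared norm of the new operator is that of
    a (b - a)^2 / L^2. Since a <= L <= 4 b / 3, the factorization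
    4 b^3 / 27 - a (b - a)^2 = (a - b / 3)^2 (4 b / 3 - a) bounds a (b - a)^2 by
    4 b^3 / 27, and 4 b^3 / (27 L^2) <= L / 2 amounts to 2 b <= 3 L. The
    factorization is checked on vectors, which avoids any functional calculus. *)
Lemma truncate_bound L T : M T -> 2 <= L ->
  (forall v, `|T v| ^+ 2 <= L * `|v| ^+ 2) ->
  forall v, `|truncate L T v| ^+ 2 <= L / 2 * `|v| ^+ 2.
Proof.
move=> MT L2 TL v.
have L0 : 0 < L by apply: lt_le_trans L2.
have LC : L^* = L by rewrite conj_Creal// gtr0_real.
have ad := adjP MT.
set a := adj T (T v); set b := L + 1.
have bC : b^* = b by rewrite rmorphD /= LC conjC1.
have lT := zmod_morphism_linear (vn_linear MT).
have lZ c u : T (c *: u) = c *: T u.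
  have T0 : T 0 = 0 by have := lT 0 0; rewrite !subrr.
  by have := vn_linear MT c u 0; rewrite T0 !addr0.
(* L times the truncation of T at v is T w. *)
set w := b *: v - a.
have -> : truncate L T v = L^-1 *: T w.
  rewrite /truncate !fctE /= -/a.
  rewrite -[T v in LHS]scale1r -{1}(mulVf (lt0r_neq0 L0)) -scalerA -scalerDr.
  by rewrite /w /b scalerDl scale1r -addrA (vn_linear MT).
pose p0 := '[v, v]; pose p1 := '[a, v]; pose p2 := '[a, a]; pose p3 := '[T a, T a].
have Tp1 : '[T v, T v] = p1 by rewrite /p1 /a (adjoint_sym ad).
have p1C : p1^* = p1 by rewrite -Tp1 -sqr_norm_inner conj_Creal// ger0_real// exprn_ge0.
have va : '[v, a] = p1 by rewrite inner_conj.
have TvTa : '[T v, T a] = p2 by rewrite /p2 {1}/a (adjoint_sym ad).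
have TaTv : '[T a, T v] = p2 by rewrite /p2 -/a ad.
have Tw : `|T w| ^+ 2 = b ^+ 2 * p1 - 2 * b * p2 + p3.
  rewrite sqr_norm_inner /w lT lZ !innerBl !innerBr !innerZl !innerZr bC Tp1 TvTa TaTv -/p3.
  ring.
(* z is (a - b / 3) applied to v, so the right-hand side of the factorization,
   evaluated at v, is 4 b / 3 |z|^2 - |T z|^2. *)
pose z := a - (b / 3) *: v.
have z2 : `|z| ^+ 2 = p2 - 2 * (b / 3) * p1 + (b / 3) ^+ 2 * p0.
  rewrite sqr_norm_inner /z !innerBl !innerBr !innerZl !innerZr.
  rewrite (_ : (b / 3)^* = b / 3); last by rewrite rmorphM /= bC fmorphV /= conjC_nat.
  rewrite va -/p0 -/p1 -/p2; ring.
have Tz2 : `|T z| ^+ 2 = p3 - 2 * (b / 3) * p2 + (b / 3) ^+ 2 * p1.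
  rewrite sqr_norm_inner /z lT lZ !innerBl !innerBr !innerZl !innerZr.
  rewrite (_ : (b / 3)^* = b / 3); last by rewrite rmorphM /= bC fmorphV /= conjC_nat.
  rewrite Tp1 TvTa TaTv -/p3; ring.
have Lb : L <= 4 / 3 * b.
  rewrite -subr_ge0 (_ : _ - _ = L / 3 + 4 / 3); last by rewrite /b; field.
  by rewrite addr_ge0 ?divr_ge0 ?(ltW L0).
have : `|T w| ^+ 2 <= 4 / 27 * b ^+ 3 * `|v| ^+ 2.
  have := le_trans (TL z) (ler_wpM2r (exprn_ge0 2 (normr_ge0 z)) Lb).
  rewrite -subr_ge0 Tz2 z2 => h; rewrite -subr_ge0 Tw sqr_norm_inner -/p0.
  by apply: le_trans h _; rewrite le_eqVlt; apply/orP; left; apply/eqP; field.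
move=> Tw_le; rewrite normrZ exprMn ger0_norm ?invr_ge0 ?(ltW L0)//.
apply: le_trans (ler_wpM2l _ Tw_le) _; first by rewrite exprn_ge0 ?invr_ge0 ?(ltW L0).
rewrite mulrA ler_wpM2r ?exprn_ge0// -subr_ge0.
(* 27 L^3 - 8 b^3 is a difference of cubes, with 3 L - 2 b = L - 2. *)
rewrite (_ : _ - _ = (L - 2) * (9 * L ^+ 2 + 6 * L * b + 4 * b ^+ 2) / (54 * L ^+ 2)).
  have b0 : 0 <= b by rewrite addr_ge0 ?(ltW L0).
  rewrite divr_ge0 ?mulr_ge0 ?subr_ge0 ?exprn_ge0 ?(ltW L0)//.
  by rewrite !addr_ge0 ?mulr_ge0 ?exprn_ge0 ?(ltW L0).
by rewrite /b; field; rewrite (lt0r_neq0 L0).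
Qed.

Lemma sqr_bounded_seq (s : nat -> H -> H) L : 0 <= L -> (forall n, M (s n)) ->
  (forall n v, `|s n v| ^+ 2 <= L * `|v| ^+ 2) -> bounded_seq (N := N) s.
Proof.
move=> L0 Ms sL; split=> //; exists (sqrtC L) => n v.
rewrite -(ler_pXn2r (ltn0Sn 1)) ?nnegrE ?mulr_ge0 ?sqrtC_ge0//.
by rewrite exprMn sqrtCK.
Qed.

Lemma norm2_nullZ (F : set_system nat) {FF : Filter F} (c : R[i]) (s : nat -> H -> H) :
  (forall n, M (s n)) -> norm2_null F s -> norm2_null F (fun n => c *: s n).
Proof.
move=> Ms; apply: (norm2_null_mull (x := fun=> c *: idfun)) => //.
split=> [n|]; first exact/vnZ/vn_id.
by exists `|c| => n v; rewrite normrZ.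
Qed.

Context (rho : freeUltrafilter).
Implicit Types x y : linfty N.
Local Notation tpi := (\pi_(tracial_ultrapower N rho)%qT).

Lemma tpi_eq x y :
  tpi x = tpi y <-> norm2_null rho (fun n => val x n - val y n).
Proof. by split=> [/eqP/tup_eqP|/tup_eqP/eqP]. Qed.

(** Truncation does not change the class: it moves x by x (1 - x* x) / L, where
    the factor 1 - x* x is null in 2-norm and x is bounded in operator norm. *)
Lemma unitary_halve x L : Defs.is_unitary (tpi x) -> 2 <= L ->
  (forall n v, `|val x n v| ^+ 2 <= L * `|v| ^+ 2) ->
  exists2 y, tpi y = tpi x & forall n v, `|val y n v| ^+ 2 <= L / 2 * `|v| ^+ 2.
Proof.
move=> /andP[/eqP xx _] L2 xL.
have L0 : 0 <= L by apply: le_trans L2.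
have yL n v := truncate_bound (linftyM x n) L2 (xL n) v.
have My n := vn_truncate L (linftyM x n).
exists (linfty_of (sqr_bounded_seq (divr_ge0 L0 (ler0n _ 2)) My yL)) => //.
apply/tpi_eq => /=.
have M1 n : M (idfun - (adj (val x n) \o val x n)).
  apply: vnB; first exact: vn_id.
  by apply: vn_comp; [apply: vn_adj|]; apply: linftyM.
have {xx} null1 : norm2_null rho (fun n => idfun - (adj (val x n) \o val x n)).
  apply/(tpi_eq (linfty1 N) (linfty_mul (linfty_adj x) x)).
  by rewrite pi_tup_mul pi_tup_adj; exact: esym xx.
have -> : (fun n => truncate L (val x n) - val x n) =
    fun n => L^-1 *: (val x n \o (idfun - (adj (val x n) \o val x n))).
  by apply/funext => n; rewrite /truncate addrAC subrr add0r.
apply: norm2_nullZ; first by move=> n; apply: vn_comp => //; apply: linftyM.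
by apply: norm2_null_mull => //; apply: linftyP.
Qed.

Lemma le_expr2 (r : R[i]) : 0 <= r -> exists k, r <= 2 ^+ k.
Proof.
move=> r0; have er : (complex.Re r)%:C%C = r by rewrite RRe_real// ger0_real.
have /archi_boundP : 0 <= complex.Re r by rewrite -ler0c er.
set k := Num.bound _ => rk; exists k; apply/ltW.
rewrite -er -natrX -(rmorph_nat (real_complex R)) ltcR.
apply: lt_trans rk _; rewrite ltr_nat.
exact: ltn_expl.
Qed.

(** A bound that is the same for every unitary, which is what allows infinitely
    many of them to be combined into one bounded double sequence. *)
Lemma unitary_lift (u : unitary_group N rho) :
  exists2 x, tpi x = val u & forall n v, `|val x n v| <= `|v|.
Proof.
have [c c0 xc] := bounded_seq_gt0 (linftyP (repr (val u))).
have [k ck] := le_expr2 (exprn_ge0 2 (ltW c0)).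
have {c c0 xc ck}: forall n v, `|val (repr (val u)) n v| ^+ 2 <= 2 ^+ k * `|v| ^+ 2.
  move=> n v; apply: le_trans (_ : c ^+ 2 * `|v| ^+ 2 <= _).
    by rewrite -exprMn ler_pXn2r ?nnegrE ?mulr_ge0 ?(ltW c0).
  by rewrite ler_wpM2r ?exprn_ge0.
have : tpi (repr (val u)) = val u by exact: reprK.
elim: k (repr (val u)) => [|k IHk] x xu xk.
  exists x => // n v; have := xk n v; rewrite expr0 mul1r.
  by rewrite ler_pXn2r ?nnegrE.
have ux : Defs.is_unitary (tpi x) by rewrite xu; apply: valP.
have [|y yx yk] := unitary_halve ux _ xk.
  by rewrite exprS ler_peMr// exprn_ege1// ler1n.
apply: (IHk y); first by rewrite yx.
by move=> n v; rewrite (le_trans (yk n v))// exprSr mulfK.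
Qed.

End Truncation.

(** * Homomorphisms from an ultrapower of G *)

Section IteratedUltrapower.
Context (R : realType) (N : tracialVN R) (omega rho : freeUltrafilter).
Local Open Scope ring_scope.
Local Notation H := (vn_space N).
Local Notation M := (vn_set N).
Local Notation orho := (prod_freeUltrafilter omega rho).

Definition iterated (X : nat -> linfty N) (k : nat) : H -> H :=
  val (X (unpair k).1) (unpair k).2.

(** Uniformity of c in j is what makes a sequence of bounded sequences a bounded
    double sequence. *)
Lemma iterated_bounded (X : nat -> linfty N) (c : R[i]) :
  (forall j n v, `|val (X j) n v| <= c * `|v|) -> bounded_seq (iterated X).
Proof.
move=> Xc; split=> [k|]; first exact: linftyM.
by exists c => k v; apply: Xc.
Qed.

Lemma norm2_null_iterated (s : nat -> nat -> H -> H) :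
  (\forall j \near ultra_set omega, norm2_null rho (s j)) ->
  norm2_null orho (fun k => s (unpair k).1 (unpair k).2).
Proof. exact: (cvg_prod_ultra (s := fun j n => norm2 (s j n) : R[i]^o)). Qed.

End IteratedUltrapower.

Section UltrapowerMorphism.
Context (R : realType) (N : tracialVN R) (omega rho : freeUltrafilter) (G : groupType).
Context (theta : {multiplicative G -> unitary_group N rho}).
Local Open Scope ring_scope.
Local Notation orho := (prod_freeUltrafilter omega rho).
Local Notation tpi r := (\pi_(tracial_ultrapower N r)%qT).

Context (f : G -> linfty N) (f_pi : forall h, tpi rho (f h) = val (theta h)).
Context (f_bound : forall h n v, `|val (f h) n v| <= `|v|).
Implicit Types h k : nat -> G.

Lemma lift_seq_bounded h : bounded_seq (iterated (f \o h)).
Proof. by apply: (@iterated_bounded _ _ _ 1) => j n v; rewrite mul1r; apply: f_bound. Qed.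

Definition lift_seq h : linfty N := linfty_of (lift_seq_bounded h).

(** Both equations hold along rho for each fixed j because f (h j) represents
    the unitary theta (h j). *)
Lemma lift_seq_unitary h : Defs.is_unitary (tpi orho (lift_seq h)).
Proof.
have uf j := valP (theta (h j)).
apply/andP; split; apply/eqP.
- apply: etrans (_ : tpi orho (linfty_mul (linfty_adj (lift_seq h)) (lift_seq h)) = _).
    by rewrite pi_tup_mul pi_tup_adj.
  apply/tpi_eq; apply: (norm2_null_iterated (s := fun j n =>
    adj (val (f (h j)) n) \o val (f (h j)) n - idfun)).
  apply: nearW => j; apply/(tpi_eq rho (linfty_mul (linfty_adj (f (h j))) (f (h j))) (linfty1 N)).
  by rewrite pi_tup_mul pi_tup_adj f_pi; have /andP[/eqP] := uf j.
- apply: etrans (_ : tpi orho (linfty_mul (lift_seq h) (linfty_adj (lift_seq h))) = _).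
    by rewrite pi_tup_mul pi_tup_adj.
  apply/tpi_eq; apply: (norm2_null_iterated (s := fun j n =>
    val (f (h j)) n \o adj (val (f (h j)) n) - idfun)).
  apply: nearW => j; apply/(tpi_eq rho (linfty_mul (f (h j)) (linfty_adj (f (h j)))) (linfty1 N)).
  by rewrite pi_tup_mul pi_tup_adj f_pi; have /andP[_ /eqP] := uf j.
Qed.

Definition ultra_theta (a : group_ultrapower G omega) : unitary_group N orho :=
  exist _ (tpi orho (lift_seq (repr a))) (lift_seq_unitary (repr a)).

(** For omega-almost all j the representative of a product is the product of the
    representatives, and there theta is multiplicative; at the other j, nothing
    is known about the operators. *)
Lemma ultra_thetaM : {morph ultra_theta : a b / (a * b)%g}.
Proof.
move=> a b; apply: val_inj => /=.
apply: etrans (_ : tpi orho (linfty_mul (lift_seq (repr a)) (lift_seq (repr b))) = _).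
  apply/tpi_eq; apply: (norm2_null_iterated (s := fun j n =>
    val (f (repr (a * b)%g j)) n - (val (f (repr a j)) n \o val (f (repr b j)) n))).
  have := near_repr omega (fun n => repr a n * repr b n)%g.
  apply: filterS => j abj.
  apply/(tpi_eq rho (f (repr (a * b)%g j)) (linfty_mul (f (repr a j)) (f (repr b j)))).
  by rewrite pi_tup_mul !f_pi [repr _ j]abj gmulfM.
exact: pi_tup_mul.
Qed.

(** Here omega has to be an ultrafilter: a <> 1 only says that a_j = 1 is not
    omega-almost sure, while vanishing of the trace needs a_j <> 1 for
    omega-almost all j. *)
Lemma ultra_theta_trace : (forall h : G, h <> 1%g -> tup_trace (val (theta h)) = 0) ->
  forall a, a <> 1%g -> tup_trace (val (ultra_theta a)) = 0.
Proof.
move=> theta0 a a1; apply: tup_trace_pi.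
apply: (cvg_prod_ultra (s := fun j n => vn_trace N (val (f (repr a j)) n) : R[i]^o)).
have [aj1|] := in_ultra_setVsetC [set j | repr a j = 1%g] (ultraP omega).
  by case: a1; rewrite -(class_modK a); apply/class_modP.
apply: filterS => j aj1; rewrite -(theta0 _ aj1) -f_pi.
exact: tup_trace_cvg.
Qed.

HB.instance Definition _ := isMultiplicative.Build _ _ ultra_theta ultra_thetaM.

Definition ultra_theta_mul : {multiplicative group_ultrapower G omega -> unitary_group N orho} :=
  ultra_theta.

End UltrapowerMorphism.

Lemma hyperlinear_group_ultrapower (R : realType) (N : tracialVN R) (G : groupType)
  (omega : freeUltrafilter) : hyperlinear N G -> hyperlinear N (group_ultrapower G omega).
Proof.
case=> rho [theta theta0].
have /choice[f fP] (h : G) : exists x : linfty N,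
    \pi_(tracial_ultrapower N rho)%qT x = val (theta h) /\
    (forall n v, `|val x n v| <= `|v|)%R.
  by have [x] := unitary_lift (theta h); exists x.
exists (prod_freeUltrafilter omega rho).
exists (ultra_theta_mul omega (fun h => (fP h).1) (fun h => (fP h).2)).
exact: ultra_theta_trace.
Qed.

Lemma hyperlinear_injective (R : realType) (N : tracialVN R) (K L : groupType)
  (i : {multiplicative K -> L}) : injective i -> hyperlinear N L -> hyperlinear N K.
Proof.
move=> i_inj [rho [theta theta0]]; exists rho, (theta \o i) => h h1.
apply: theta0 => ih1.
(* If i h = 1 then i (h * h) = i h, so h is idempotent. *)
by apply: h1; apply: (mulgI h); apply: i_inj; rewrite gmulfM mulg1 ih1 mulg1.
Qed.

Unset Implicit Arguments.

Theorem proposition3p4 (R : realType) (N : tracialVN R)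
    (HN : is_hyperfinite_II1_factor N)
    (G : groupType) (G_countable : countable [set: G])
    (g : nat -> G) (g_generates : generates g)
    (omega : freeUltrafilter) (I : set (set nat))
    (I_infinite : forall F, I F -> infinite_set F)
    (I_almost_disjoint : forall F1 F2, I F1 -> I F2 -> F1 <> F2 ->
       finite_set (F1 `&` F2)) :
  hyperlinear N G -> hyperlinear N (G_omega_I g omega I).
Proof.
move=> /(hyperlinear_group_ultrapower omega).
apply: (hyperlinear_injective (i := val)); exact: val_inj.
Qed.
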